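(* Let $G$ be a distinguished group, let $A$ be a simple subgroup of $G$ of order $v$, and let $R$ be a subgroup of $G$ of order $v^2$ which contains $A$. If $$R=A.l_1+A.l_2+\cdots+A.l_v,\qquad l_1\in A,$$ is a decomposition of $R$ into pairwise disjoint sets, then for every $h=1,\dots,v$ and every $x\in G$ $$(A.l_h).(A.x)=A.(l_h.x).$$
   Context: A distributive group is a nonempty set $G$ with a binary operation $(a,b)\mapsto a.b$ on $G$ such that for all $a,b\in G$ each of the equations $a.x=b$ and $y.a=b$ has exactly one solution in $G$, and for all $a,b,c\in G$, $(a.b).c=(a.c).(b.c)$ and $c.(a.b)=(c.a).(c.b)$. A subgroup of $G$ is a nonempty subset which is itself a distributive group under the restricted operation; the order is the number of elements. A distributive group is simple if it has no proper subgroup of order greater than one. For subsets $X,Y\subseteq G$ and $p\in G$: $X.Y=\{x.y: x\in X,\,y\in Y\}$, $X.p=\{x.p: x\in X\}$, $p.X=\{p.x:x\in X\}$. A finite distributive group $G$ is called distinguished if for every subgroup $B$ of $G$ and every $p\in G$, the sets $B.(B.p)$ and $(B.p).B$ are subgroups of the same order as $B$; equivalently there are $t,\tau\in G$ with $B.(B.p)=B.t$ and $(B.p).B=B.(p.B)=B.\tau$. *)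

(* Defs.v *)
From mathcomp Require Import all_boot.

Set Implicit Arguments.
Unset Strict Implicit.
Unset Printing Implicit Defensive.

Section DistributiveGroups.

Variables (T : finType) (op : T -> T -> T).
Implicit Types (B X Y : {set T}) (p : T).

Definition setop X Y : {set T} := [set op x y | x in X, y in Y].

Definition setop_r X p : {set T} := [set op x p | x in X].

(* [B] is a distributive group under the restriction of [op]. An ambient
   distributive group is the case [B = [set: T]]; its subgroups are then exactly
   the sets [B] satisfying this predicate. *)
Record distributive_group B : Prop := DistributiveGroup {
  dg_nonempty : B != set0;
  dg_closed : {in B &, forall a b, op a b \in B};
  dg_ldiv : {in B &, forall a b, exists! x, x \in B /\ op a x = b};
  dg_rdiv : {in B &, forall a b, exists! y, y \in B /\ op y a = b};
  dg_distr_r : {in B & &, forall a b c, op (op a b) c = op (op a c) (op b c)};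
  dg_distr_l : {in B & &, forall a b c, op c (op a b) = op (op c a) (op c b)}
}.

Definition simple_group B : Prop :=
  distributive_group B /\
  forall C : {set T}, distributive_group C -> C \proper B -> ~~ (1 < #|C|).

Definition distinguished_group : Prop :=
  distributive_group [set: T] /\
  forall B p, distributive_group B ->
    [/\ distributive_group (setop B (setop_r B p)),
        #|setop B (setop_r B p)| = #|B|,
        distributive_group (setop (setop_r B p) B)
      & #|setop (setop_r B p) B| = #|B|].

End DistributiveGroups.

(* Main.v *)
Require Import Defs.
From mathcomp Require Import all_boot.

Set Implicit Arguments.
Unset Strict Implicit.
Unset Printing Implicit Defensive.

(** Only the inclusion of the product [(A.l_h).(A.x)] in [A.(l_h.x)] is at
    stake, since [a.(l_h.x) = (a.l_h).(a.x)].  Fix [b] in [A], put [y = b.x],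
    and let [E = A.(l_h.x)]; it is enough to show [(A.l_h).y = E].

    Translations are injective endomorphisms, so all the sets [A.p] and
    [(A.p).q] are subgroups of order [v] without proper nontrivial subgroups.
    In a distinguished group, [B.(B.p) = B.(b.p)] for every [b] in [B]
    ([setop_setop_r]); consequently the sets [B.p] partition the group
    ([setop_r_meet_eq]), and [E], which lies in [R.(R.x) = R.y], is covered by
    the [v] pairwise disjoint sets [(A.l_i).y].  By simplicity [E] either is one
    of these sets or meets each of them in at most one point
    ([simple_translate_sub]).  In the latter case, as [E] has [v] elements, it
    meets all [v] of them, in particular [(A.l_1).y = A.y]; but then [E = A.y]
    because both are cosets of [A].  So [E = (A.l_i).y] for some [i] in either
    case, and [i = h] because [b.(l_h.x) = (b.l_h).y] is a common point of [E]
    and [(A.l_h).y]. *)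

Lemma card_bigcup_le_size (I : eqType) (T : finType) (r : seq I) (F : I -> {set T}) :
  {in r, forall i, #|F i| <= 1} -> #|\bigcup_(i <- r) F i| <= size r.
Proof.
elim: r => [|i r IHr] F1; first by rewrite big_nil cards0.
rewrite big_cons (leq_trans (leq_card_setU _ _)) //= -add1n leq_add //.
  by rewrite F1 ?mem_head.
by apply: IHr => j jr; rewrite F1 // inE jr orbT.
Qed.

Lemma mem_bigcup_seq (I : eqType) (T : finType) (r : seq I) (F : I -> {set T}) x :
  reflect (exists2 i, i \in r & x \in F i) (x \in \bigcup_(i <- r) F i).
Proof.
rewrite (big_morph (fun B : {set T} => x \in B) (in_setU x) (in_set0 x)) big_has.
exact: hasP.
Qed.

Section DistributiveGroup.

Variables (T : finType) (op : T -> T -> T).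
Hypothesis opT : distributive_group op [set: T].

Local Notation "a · b" := (op a b) (at level 40, left associativity).

Implicit Types (A B E : {set T}).

Let dr a b c : a · b · c = (a · c) · (b · c).
Proof. by apply: (dg_distr_r opT); rewrite inE. Qed.

Lemma op_injl a : injective (op a).
Proof.
move=> x y exy; have [||z [_ uz]] := @dg_ldiv _ _ _ opT a (a · x); try by rewrite inE.
by rewrite -(uz x) ?(uz y) ?inE.
Qed.

Lemma op_injr a : injective (op^~ a).
Proof.
move=> x y exy; have [||z [_ uz]] := @dg_rdiv _ _ _ opT a (x · a); try by rewrite inE.
by rewrite -(uz x) ?(uz y) ?inE.
Qed.

Lemma card_setop_r B p : #|setop_r op B p| = #|B|.
Proof. by rewrite card_imset //; apply: op_injr. Qed.

(** By finiteness, an injective translation that maps [B] into itself is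
    already onto [B], so divisibility need not be checked. *)
Lemma closed_distributive_group B :
  B != set0 -> {in B &, forall a b, a · b \in B} -> distributive_group op B.
Proof.
move=> B0 Bop.
have onto (f : T -> T) b : injective f -> {in B, forall x, f x \in B} -> b \in B ->
    exists! x, x \in B /\ f x = b.
  move=> fI fB bB; have : b \in f @: B.
    suff -> : f @: B = B by [].
    apply/eqP; rewrite eqEcard card_imset // leqnn andbT.
    by apply/subsetP=> _ /imsetP[x xB ->]; apply: fB.
  case/imsetP=> x xB ->; exists x; split=> // z [_ /fI] //.
split=> //.
- by move=> a b aB bB; apply: onto => // [|x xB]; [apply: op_injl | apply: Bop].
- by move=> a b aB bB; apply: (onto (op^~ a)) => // [|x xB]; [apply: op_injr | apply: Bop].
- by move=> a b c _ _ _; apply: (dg_distr_l opT); rewrite inE.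
Qed.

Lemma subgroup_ldiv B b c : distributive_group op B -> b \in B -> c \in B ->
  exists2 d, d \in B & c = b · d.
Proof. by move=> gB bB cB; have [d [[dB <-] _]] := dg_ldiv gB bB cB; exists d. Qed.

Lemma setop_r_closed B p : distributive_group op B ->
  {in setop_r op B p &, forall a b, a · b \in setop_r op B p}.
Proof.
move=> gB _ _ /imsetP[a aB ->] /imsetP[b bB ->].
by rewrite -dr imset_f ?(dg_closed gB).
Qed.

Lemma setop_r_mem B p : distributive_group op B -> p \in B -> setop_r op B p = B.
Proof.
move=> gB pB; apply/eqP; rewrite eqEcard card_setop_r leqnn andbT.
by apply/subsetP=> _ /imsetP[a aB ->]; apply: (dg_closed gB).
Qed.

(** The elements of [A] that the injective endomorphism [a |-> (a.p).q] sends
    into [E] form a subgroup of [A], which by simplicity is [A] itself as soon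
    as it has two elements. *)
Lemma simple_translate_sub A E p q :
  simple_group op A -> {in E &, forall a b, a · b \in E} ->
  1 < #|E :&: setop_r op (setop_r op A p) q| ->
  setop_r op (setop_r op A p) q \subset E.
Proof.
move=> [gA sA] Eop E1; pose f a := a · p · q.
have fI : injective f by move=> a b /op_injr/op_injr.
have fM a b : f (a · b) = f a · f b by rewrite /f (dr a b p) dr.
have fA : setop_r op (setop_r op A p) q = f @: A by rewrite /setop_r -imset_comp.
pose C := [set a in A | f a \in E].
have EC : E :&: setop_r op (setop_r op A p) q = f @: C.
  rewrite fA; apply/setP=> z; rewrite inE.
  apply/andP/imsetP=> [[zE /imsetP[a aA def_z]]|[a]].
    by exists a; rewrite // inE aA -def_z.
  by rewrite inE => /andP[aA faE] ->; split; rewrite ?imset_f.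
rewrite EC card_imset // in E1.
have gC : distributive_group op C.
  apply: closed_distributive_group; first by rewrite -card_gt0 ltnW.
  move=> a b /[!inE] /andP[aA aE] /andP[bA bE].
  by rewrite (dg_closed gA) //= fM Eop.
have CA : C = A.
  have sCA : C \subset A by apply/subsetP=> a /[!inE] /andP[].
  apply/eqP; rewrite eqEproper sCA.
  by apply/negP=> /(sA _ gC); rewrite E1.
by rewrite fA -{1}CA -EC subsetIl.
Qed.

End DistributiveGroup.

Section DistinguishedGroup.

Variables (T : finType) (op : T -> T -> T).
Hypothesis G_distinguished : distinguished_group op.

Local Notation "a · b" := (op a b) (at level 40, left associativity).

Let opT : distributive_group op [set: T] := proj1 G_distinguished.

Let dl a b c : c · (a · b) = (c · a) · (c · b).
Proof. by apply: (dg_distr_l opT); rewrite inE. Qed.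

Implicit Types (A B : {set T}).

(** Since [b.B = B], the set [B.(b.p) = b.(B.p)] is contained in [B.(B.p)], and
    both have the order of [B]. *)
Lemma setop_setop_r B b p : distributive_group op B -> b \in B ->
  setop op B (setop_r op B p) = setop_r op B (b · p).
Proof.
move=> gB bB; have [_ oB _ _] := proj2 G_distinguished _ p gB.
apply/esym/eqP; rewrite eqEcard oB card_setop_r // leqnn andbT.
apply/subsetP=> _ /imsetP[c cB ->].
have [d dB ->] := subgroup_ldiv gB bB cB.
by rewrite -dl; apply: imset2_f => //; apply: imset_f.
Qed.

Lemma setop_r_meet_eq B p q z : distributive_group op B ->
  z \in setop_r op B p -> z \in setop_r op B q -> setop_r op B p = setop_r op B q.
Proof.
move=> gB /imsetP[b bB ->] /imsetP[c cB ebc].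
apply/eqP; rewrite eqEcard !card_setop_r // leqnn andbT.
apply/subsetP=> _ /imsetP[a aB ->].
(* Multiplying by [b] on the left leads into [B.(B.p) = B.(B.q)], where the
   factor [b] can be split off again. *)
have: b · (a · p) \in setop op B (setop_r op B p).
  by apply: imset2_f => //; apply: imset_f.
rewrite (setop_setop_r p gB bB) ebc -(setop_setop_r q gB cB) (setop_setop_r q gB bB).
case/imsetP=> d dB; have [e eB ->] := subgroup_ldiv gB bB dB.
by rewrite -dl => /(op_injl opT) ->; apply: imset_f.
Qed.

End DistinguishedGroup.

Theorem theorem5p12 (T : finType) (op : T -> T -> T) (A R : {set T}) (v : nat)
    (l : nat -> T)
    (G_distinguished : distinguished_group op)
    (A_simple : simple_group op A) (A_order : #|A| = v)
    (R_subgroup : distributive_group op R) (R_order : #|R| = v ^ 2)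
    (A_sub_R : A \subset R)
    (R_decomposition : R = \bigcup_(1 <= i < v.+1) setop_r op A (l i))
    (R_disjoint : forall i j : nat, 1 <= i <= v -> 1 <= j <= v -> i <> j ->
       [disjoint setop_r op A (l i) & setop_r op A (l j)])
    (l1_in_A : l 1 \in A) :
  forall (h : nat) (x : T), 1 <= h <= v ->
    setop op (setop_r op A (l h)) (setop_r op A x) = setop_r op A (op (l h) x).
Proof.
move=> h x h_v; have opT := proj1 G_distinguished; have gA := proj1 A_simple.
have dl a b c : op c (op a b) = op (op c a) (op c b).
  by apply: (dg_distr_l opT); rewrite inE.
have v_gt0 : 0 < v by rewrite -A_order card_gt0 (dg_nonempty gA).
have memR i a : 1 <= i <= v -> a \in A -> op a (l i) \in R.
  move=> i_v aA; rewrite R_decomposition.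
  by apply/mem_bigcup_seq; exists i; rewrite ?mem_index_iota // imset_f.
set E := setop_r op A (op (l h) x).
have E_closed : {in E &, forall a b, op a b \in E} by apply: setop_r_closed.
have E_order : #|E| = v by rewrite card_setop_r.
suff E_eq b : b \in A -> setop_r op (setop_r op A (l h)) (op b x) = E.
  apply/setP=> z; apply/imset2P/idP=> [[u _ uA /imsetP[b bA ->] ->]|/imsetP[a aA ->]].
    by rewrite -(E_eq b bA) imset_f.
  by exists (op a (l h)) (op a x); rewrite ?imset_f.
move=> bA; set y := op b x; pose X i := setop_r op (setop_r op A (l i)) y.
have X_order i : #|X i| = v by rewrite !card_setop_r.
have E_cover z : z \in E -> exists2 i, 1 <= i <= v & z \in X i.
  case/imsetP=> a aA ->; rewrite dl.
  have: op (op a (l h)) (op a x) \in setop op R (setop_r op R x).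
    by rewrite imset2_f ?memR // imset_f // (subsetP A_sub_R).
  rewrite (setop_setop_r G_distinguished x R_subgroup (subsetP A_sub_R b bA)).
  case/imsetP=> r; rewrite R_decomposition => /mem_bigcup_seq[i].
  by rewrite mem_index_iota => i_v rA ->; exists i; rewrite // imset_f.
have X_eq i : 1 < #|E :&: X i| -> E = X i.
  move/(simple_translate_sub opT A_simple E_closed) => sXE.
  by apply/esym/eqP; rewrite eqEcard sXE E_order X_order leqnn.
have [i i_v EX] : exists2 i, 1 <= i <= v & E = X i.
  have [/existsP[i /X_eq ?]|] := boolP [exists i : 'I_v, 1 < #|E :&: X i.+1|].
    by exists i.+1; rewrite //= ltn_ord.
  rewrite negb_exists => /forallP small.
  exists 1 => //; rewrite /X (setop_r_mem opT gA l1_in_A).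
  have [E1|] := eqVneq (E :&: X 1) set0; last first.
    case/set0Pn=> z; rewrite inE /X (setop_r_mem opT gA l1_in_A) => /andP[].
    exact: setop_r_meet_eq.
  (* Otherwise [v - 1] sets with at most one element each would cover [E]. *)
  have: E \subset \bigcup_(2 <= i < v.+1) (E :&: X i).
    apply/subsetP=> z zE; have [i /andP[i1 i_v] zX] := E_cover z zE.
    apply/mem_bigcup_seq; exists i; last by rewrite inE zE.
    rewrite mem_index_iota ltnS i_v andbT ltn_neqAle i1 andbT.
    apply: contra_eqN E1 => /eqP i0; apply/set0Pn; exists z.
    by rewrite inE zE i0.
  move/subset_leq_card; rewrite E_order leqNgt => /negP[].
  have sz : size (index_iota 2 v.+1) < v by rewrite size_iota subSS subn1 prednK.
  apply: leq_ltn_trans sz; apply: card_bigcup_le_size => i.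
  rewrite mem_index_iota; case: i => // i /andP[_ i_v].
  by rewrite leqNgt (small (Ordinal (i_v : i < v))).
have [<- //|] := eqVneq i h; move/eqP=> ne_ih.
have : op (op b (l h)) y \in X i by rewrite -EX -dl imset_f.
case/imsetP=> u uA /(op_injr opT) eu.
have := disjointFr (R_disjoint i h i_v h_v ne_ih) uA.
by rewrite -eu imset_f.
Qed.
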